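(* Let $n\geq 4$ and $\varphi,\psi\in S_n$. The following conditions are equivalent: (i) there is $\alpha\in S_n$ with $\varphi^\alpha=\psi$, i.e. $\alpha\varphi=\psi\alpha$ (so $\varphi$ and $\psi$ are conjugate in $S_n$); (ii) the configurations $\mathfrak{M}_{(n,\varphi)}$ and $\mathfrak{M}_{(n,\psi)}$ are isomorphic.
   Context: A configuration is a pair $\langle S,\mathcal L\rangle$ where $S$ is a set of points and $\mathcal L$ is a family of subsets of $S$, called blocks. Two configurations $\langle S_1,\mathcal L_1\rangle$ and $\langle S_2,\mathcal L_2\rangle$ are isomorphic if there is a bijection $f\colon S_1\to S_2$ such that, for $k\subseteq S_1$, $k\in\mathcal L_1$ iff $f(k)\in\mathcal L_2$. Let $n\ge 3$, $I=\{1,\dots,n\}$, $\varphi\in S_n$ a permutation of $I$, and let $A=\{a_1,\dots,a_n\}$, $B=\{b_1,\dots,b_n\}$ be disjoint $n$-element sets. For $i\in I$ put $A_i=(A\setminus\{a_i\})\cup\{b_i\}$ and $B_i=(B\setminus\{b_i\})\cup\{a_{\varphi(i)}\}$. The Möbius $n$-pair $\mathfrak{M}_{(n,\varphi)}$ is the configuration with point set $A\cup B$ and block set $\{A_i: i\in I\}\cup\{B_i: i\in I\}$. *)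

(* Defs.v *)
From mathcomp Require Import all_boot all_fingroup.

Set Implicit Arguments.
Unset Strict Implicit.
Unset Printing Implicit Defensive.

(* Configurations with finitely many points; no condition is put on blocks. *)
Record configuration := Configuration {
  point : finType;
  blocks : {set {set point}}
}.

Definition isomorphic (M1 M2 : configuration) : Prop :=
  exists f : point M1 -> point M2,
    bijective f /\
    forall k : {set point M1}, k \in blocks M1 <-> f @: k \in blocks M2.

Section MobiusPair.

Variable n : nat.

(* The disjoint n-element sets A and B are the two summands of this type;
   indices run over 0, ..., n - 1. *)
Definition mpoint : finType := ('I_n + 'I_n)%type.

Definition apt (i : 'I_n) : mpoint := inl i.
Definition bpt (i : 'I_n) : mpoint := inr i.

Definition Apts : {set mpoint} := [set apt i | i : 'I_n].
Definition Bpts : {set mpoint} := [set bpt i | i : 'I_n].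

Definition Ablock (i : 'I_n) : {set mpoint} :=
  (Apts :\ apt i) :|: [set bpt i].

Definition Bblock (phi : 'S_n) (i : 'I_n) : {set mpoint} :=
  (Bpts :\ bpt i) :|: [set apt (phi i)].

Definition mobius_pair (phi : 'S_n) : configuration :=
  Configuration ([set Ablock i | i : 'I_n] :|: [set Bblock phi i | i : 'I_n]).

End MobiusPair.

(* Main.v *)
Require Import Defs.
From mathcomp Require Import all_boot all_fingroup.

Set Implicit Arguments.
Unset Strict Implicit.
Unset Printing Implicit Defensive.

(** Join two points when fewer than two blocks contain both. For [n >= 4] the
    edges of this graph on the points of a Moebius pair are exactly
    [a_i -- b_i] and [b_i -- a_(phi i)], so a cycle of [phi] of length [k] gives
    a connected component with [2k] points. An isomorphism need not respect the
    partition of the points into [A] and [B], but it carries components to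
    components of the same size; hence it induces a length-preserving matching
    of the cycles of the two permutations, which are therefore conjugate. *)

(** * Conjugacy from a length-preserving matching of cycles *)

Section Conjugacy.

Variable T : finType.
Implicit Types (s t : {perm T}) (x y : T).

(** The iterates of [x] under [s] are periodic with period the orbit size, and those of one period
    are pairwise distinct. *)
Lemma eq_permX_mod_porbit s x k l :
  ((s ^+ k)%g x == (s ^+ l)%g x) = (k == l %[mod #|porbit s x|]).
Proof.
have p_gt0 : 0 < #|porbit s x| by rewrite lt0n card_porbit_neq0.
have modE m : iter m s x = iter (m %% #|porbit s x|) s x.
  rewrite {1}(divn_eq m #|porbit s x|) addnC iterD; congr iter.
  elim: (m %/ _) => [|q IHq] //.
  by rewrite mulSn addnC iterD iter_porbit.
rewrite !permX (modE k) (modE l).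
rewrite -!(nth_traject s (n := #|porbit s x|)) ?ltn_mod //.
by rewrite nth_uniq ?size_traject ?ltn_mod // uniq_traject_porbit.
Qed.

(** Only the cycle containing [h x] matters, so [h] may fail to be injective. With a base point
    [r x] chosen in each cycle of [s], the conjugating permutation sends the [m]-th iterate of [r x]
    under [s] to the [m]-th iterate of [h (r x)] under [t]. *)
Lemma conjg_of_porbit_map s t (h : T -> T) :
    (forall x y, (h x \in porbit t (h y)) = (x \in porbit s y)) ->
    (forall x, #|porbit t (h x)| = #|porbit s x|) ->
  exists a : {perm T}, (s ^ a)%g = t.
Proof.
move=> h_orb h_card.
(* The default is never reached, as the orbit contains [x]; the pick depends only on the orbit, so
   [r] is constant on cycles. *)
pose r x := odflt x [pick y in porbit s x].
have r_in x : x \in porbit s (r x).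
  rewrite /r porbit_sym; case: pickP => //= _; exact: porbit_id.
have r_eq x y : x \in porbit s y -> r x = r y.
  rewrite -eq_porbit_mem /r => /eqP->.
  by case: pickP => //= /(_ y); rewrite porbit_id.
have exk x : exists k, x == (s ^+ k)%g (r x).
  by have /porbitP[k xE] := r_in x; exists k; apply/eqP.
pose k x := ex_minn (exk x).
have kE x : (s ^+ k x)%g (r x) = x by rewrite /k; case: ex_minnP => m /eqP.
pose f x := (t ^+ k x)%g (h (r x)).
(* The exponent matters only modulo the cycle length, which [h] preserves; hence any [m] may replace
   the minimal one. *)
have fE m x : f ((s ^+ m)%g (r x)) = (t ^+ m)%g (h (r x)).
  set y := (s ^+ m)%g (r x).
  have ry : r y = r x.
    by rewrite -[RHS](r_eq y) // /y -eq_porbit_mem porbit_perm eq_porbit_mem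
      porbit_sym.
  rewrite /f ry; apply/eqP.
  by rewrite eq_permX_mod_porbit h_card -eq_permX_mod_porbit -{1}ry kE.
have f_inj : injective f.
  move=> x y eq_f.
  have rxy : r x = r y.
    have: h (r x) \in porbit t (h (r y)).
      rewrite -eq_porbit_mem -(porbit_perm t (k x)) -/(f x) eq_f.
      by rewrite /f porbit_perm.
    rewrite h_orb => /r_eq.
    by rewrite -!(r_eq _ _ (r_in _)).
  move/eqP: eq_f; rewrite /f rxy eq_permX_mod_porbit h_card.
  by rewrite -eq_permX_mod_porbit -{1}rxy !kE => /eqP.
exists (perm f_inj); apply/permP=> y.
rewrite -[y](permKV (perm f_inj)); set x := ((perm f_inj)^-1)%g y.
rewrite conjgE !permM permK !permE -{1}(kE x) -permM -expgSr fE.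
by rewrite expgSr permM.
Qed.

End Conjugacy.

(** * The graph of pairs with few common blocks, and its invariance *)

Section SparseGraph.

Definition common (M : configuration) (x y : point M) : {set {set point M}} :=
  [set k in blocks M | (x \in k) && (y \in k)].

Definition sparse (M : configuration) : rel (point M) :=
  fun x y => #|common x y| < 2.

Lemma sparse_sym (M : configuration) : symmetric (@sparse M).
Proof.
move=> x y; rewrite /sparse; congr (#|pred_of_set _| < 2).
by apply/setP=> k; rewrite !inE [in LHS](andbC (x \in k)).
Qed.

Variables (M1 M2 : configuration) (f : point M1 -> point M2).
Hypotheses (f_bij : bijective f)
  (f_iso : forall k, k \in blocks M1 <-> f @: k \in blocks M2).

(** Taking images under [f] maps the common blocks of [x] and [y] bijectively onto those of [f x]
    and [f y]. *)
Lemma iso_sparse x y : sparse (f x) (f y) = sparse x y.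
Proof.
have [g fK gK] := f_bij; have f_inj := can_inj fK.
rewrite /sparse -(card_imset (mem (common x y)) (imset_inj f_inj)).
congr (#|pred_of_set _| < 2); apply/setP=> k.
have -> : k = f @: (g @: k) by rewrite -imset_comp (eq_imset _ gK) imset_id.
rewrite (mem_imset _ _ (imset_inj f_inj)) !inE !(mem_imset _ _ f_inj).
by congr (_ && _); apply/idP/idP => /f_iso.
Qed.

Lemma iso_connect_sparse x y :
  connect (@sparse M2) (f x) (f y) = connect (@sparse M1) x y.
Proof.
have [g fK gK] := f_bij.
apply/idP/idP => /connectP[p ep lastp].
  apply/connectP; exists (map g p); last by rewrite -[x]fK last_map -lastp fK.
  rewrite -[x]fK; apply: homo_path ep => u v.
  by rewrite -{1}[u]gK -{1}[v]gK iso_sparse.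
apply/connectP; exists (map f p); last by rewrite last_map -lastp.
by apply: homo_path ep => u v; rewrite iso_sparse.
Qed.

Lemma card_iso_connect_sparse x :
  #|connect (@sparse M2) (f x)| = #|connect (@sparse M1) x|.
Proof.
have [g fK gK] := f_bij; rewrite -(card_image (can_inj fK)).
apply: eq_card => y; rewrite -[y]gK (mem_image (can_inj fK)).
exact: iso_connect_sparse.
Qed.

End SparseGraph.

(** * Incidence in a Moebius pair *)

Section MobiusPairBlocks.

Variables (n : nat) (phi : 'S_n).
Implicit Types i j k l : 'I_n.

Lemma apt_Ablock i j : (apt j \in Ablock i) = (j != i).
Proof. by rewrite !inE mem_imset ?andbT ?orbF //; move=> ? ? []. Qed.

Lemma bpt_Ablock i j : (bpt j \in Ablock i) = (j == i).
Proof.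
rewrite !inE; case: imsetP => [[]//|_]; rewrite andbF /=.
by apply/eqP/eqP => [[]|->].
Qed.

Lemma apt_Bblock i j : (apt j \in Bblock phi i) = (j == phi i).
Proof.
rewrite !inE; case: imsetP => [[]//|_]; rewrite andbF /=.
by apply/eqP/eqP => [[]|->].
Qed.

Lemma bpt_Bblock i j : (bpt j \in Bblock phi i) = (j != i).
Proof. by rewrite !inE mem_imset ?andbT ?orbF //; move=> ? ? []. Qed.

Definition mem_mobius_block :=
  (apt_Ablock, bpt_Ablock, apt_Bblock, bpt_Bblock).

Lemma Ablock_in i : Ablock i \in blocks (mobius_pair phi).
Proof. by rewrite inE imset_f. Qed.

Lemma Bblock_in i : Bblock phi i \in blocks (mobius_pair phi).
Proof. by rewrite inE orbC imset_f. Qed.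

Lemma mobius_blockP (k : {set mpoint n}) :
  k \in blocks (mobius_pair phi) ->
  (exists i, k = Ablock i) \/ (exists i, k = Bblock phi i).
Proof. by rewrite inE => /orP[] /imsetP[i _ ->]; [left|right]; exists i. Qed.

End MobiusPairBlocks.

(** * Edges and components of the graph of a Moebius pair *)

Section MobiusPairComponents.

Variables (n : nat) (phi : 'S_n).
Implicit Types i j k l : 'I_n.
Hypothesis hn : 4 <= n.

Notation sparse := (@sparse (mobius_pair phi)).

Definition index_of (x : mpoint n) : 'I_n :=
  match x with inl i => i | inr i => i end.

(** This is where [4 <= n] enters: removing at most two indices leaves at least two. *)
Lemma two_other_indices (i j : 'I_n) :
  exists k l, [/\ k != l, k != i, k != j, l != i & l != j].
Proof.
have: 1 < #|~: [set i; j]|.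
  have := cardsC [set i; j]; rewrite card_ord cards2 => cE.
  by rewrite -(ltn_add2l (i != j).+1) cE; apply: leq_trans hn; case: (i != j).
case/card_gt1P=> k [l []]; rewrite !inE !negb_or.
by move=> /andP[? ?] /andP[? ?] ?; exists k, l.
Qed.

Lemma not_sparse (x y : mpoint n) (k l : {set mpoint n}) :
    k \in blocks (mobius_pair phi) -> l \in blocks (mobius_pair phi) ->
    k != l -> x \in k -> y \in k -> x \in l -> y \in l ->
  sparse x y = false.
Proof.
move=> kM lM kl xk yk xl yl; apply/negbTE; rewrite -leqNgt.
by apply/card_gt1P; exists k, l; rewrite !inE -!in_setU kM lM xk yk xl yl.
Qed.

(** Any [Ablock k] with [k] distinct from [i] and [j] contains both points, and there are two such
    blocks, told apart by [bpt k]. *)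
Lemma sparse_apt_apt i j : sparse (apt i) (apt j) = false.
Proof.
have [k [l [kl ki kj li lj]]] := two_other_indices i j.
apply: (not_sparse (Ablock_in phi k) (Ablock_in phi l));
  rewrite ?mem_mobius_block 1?eq_sym //.
apply: contraNneq kl => eq_kl.
by rewrite -(bpt_Ablock l k) eq_kl bpt_Ablock.
Qed.

Lemma sparse_bpt_bpt i j : sparse (bpt i) (bpt j) = false.
Proof.
have [k [l [kl ki kj li lj]]] := two_other_indices i j.
apply: (not_sparse (Bblock_in phi k) (Bblock_in phi l));
  rewrite ?mem_mobius_block 1?eq_sym //.
apply: contraNneq kl => eq_kl.
by rewrite -(inj_eq (@perm_inj _ phi)) -(apt_Bblock phi l) eq_kl apt_Bblock.
Qed.

(** The only A-block through [bpt j] is [Ablock j], and the only B-block through [apt i] has index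
    the preimage of [i] under [phi]. The first misses [apt i] exactly when [i = j], the second
    misses [bpt j] exactly when [i = phi j]. *)
Lemma sparse_apt_bpt i j :
  sparse (apt i) (bpt j) = (i == j) || (i == phi j).
Proof.
apply/idP/orP; last first.
  case=> /eqP ij; apply: leq_ltn_trans (ltnSn 1).
    rewrite -(cards1 (Bblock phi ((phi^-1)%g i))); apply: subset_leq_card.
    apply/subsetP=> k; rewrite inE => /andP[/mobius_blockP[] [l ->]].
      by rewrite !mem_mobius_block ij eq_sym; case: eqP.
    by rewrite !mem_mobius_block => /andP[/eqP-> _]; rewrite permK set11.
  rewrite -(cards1 (Ablock j)); apply: subset_leq_card.
  apply/subsetP=> k; rewrite inE => /andP[/mobius_blockP[] [l ->]].
    by rewrite !mem_mobius_block => /andP[_ /eqP->]; rewrite set11.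
  rewrite !mem_mobius_block ij (inj_eq (@perm_inj _ phi)).
  by case: eqP.
move=> sp; apply/orP; apply: contraTT sp; rewrite negb_or => /andP[ij ipj].
suff -> : sparse (apt i) (bpt j) = false by [].
have ji : j != (phi^-1)%g i.
  by apply: contraNneq ipj => ->; rewrite permKV.
apply: (not_sparse (Ablock_in phi j) (Bblock_in phi ((phi^-1)%g i)));
  rewrite ?mem_mobius_block ?permKV //.
(* A further index [k] separates the two blocks: [apt k] lies in [Ablock j], whereas [apt i] is the
   only A-point of the B-block. *)
have [k [_ [_ kj ki _ _]]] := two_other_indices j i.
apply: contraNneq ki => eq_AB.
have: apt k \in Ablock j by rewrite apt_Ablock.
by rewrite eq_AB apt_Bblock permKV.
Qed.

Lemma sparse_porbit x y :
  sparse x y -> porbit phi (index_of x) = porbit phi (index_of y).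
Proof.
have ab i j : sparse (apt i) (bpt j) -> porbit phi i = porbit phi j.
  rewrite sparse_apt_bpt => /orP[] /eqP-> //.
  by rewrite -[phi j]/(iter 1 phi j) -permX porbit_perm.
case: x y => [i|i] [j|j]; rewrite -?/(apt i) -?/(apt j) -?/(bpt i) -?/(bpt j).
- by rewrite sparse_apt_apt.
- exact: ab.
- by rewrite sparse_sym => /ab.
- by rewrite sparse_bpt_bpt.
Qed.

(** Every edge keeps the index within its cycle; conversely the path from [apt i] through [bpt i] to
    [apt (phi i)] advances one step along the cycle. *)
Lemma connect_sparse x y :
  connect sparse x y = (index_of x \in porbit phi (index_of y)).
Proof.
have csym := sym_connect_sym (@sparse_sym (mobius_pair phi)).
rewrite -eq_porbit_mem; apply/idP/eqP.
  case/connectP=> p; elim: p x => [|z p IHp] x /= => [_ -> //|].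
  by case/andP=> /sparse_porbit-> /IHp; apply.
have ab i : connect sparse (apt i) (bpt i).
  by apply: connect1; rewrite sparse_apt_bpt eqxx.
have step m i : connect sparse (apt i) (apt ((phi ^+ m)%g i)).
  elim: m => [|m IHm]; first by rewrite perm1 connect0.
  rewrite expgSr permM; apply: connect_trans IHm _.
  apply: connect_trans (ab _) _; rewrite csym; apply: connect1.
  by rewrite sparse_apt_bpt eqxx orbT.
have toA z : connect sparse z (apt (index_of z)).
  by case: z => i /=; rewrite ?connect0 // csym ab.
move=> eq_orb; apply: connect_trans (toA x) _; rewrite csym.
apply: connect_trans (toA y) _.
have: index_of x \in porbit phi (index_of y) by rewrite -eq_porbit_mem eq_orb.
by case/porbitP=> m ->; apply: step.
Qed.

Lemma card_connect_sparse x :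
  #|connect sparse x| = (#|porbit phi (index_of x)|).*2.
Proof.
have -> : #|connect sparse x| =
    #|[pred y : mpoint n | index_of y \in porbit phi (index_of x)]|.
  by apply: eq_card => y; rewrite !inE -[LHS]/(connect _ _ _) connect_sparse
    porbit_sym.
(* Each index of the cycle is counted once in A and once in B. *)
rewrite -!sum1_card big_sumType /= -addnn.
by congr (_ + _); apply: eq_bigl => i; rewrite inE.
Qed.

End MobiusPairComponents.

(** * Conjugate permutations give isomorphic pairs, by relabelling indices *)

Section ConjugateToIsomorphic.

Variables (n : nat) (phi alpha : 'S_n).
Implicit Types i j : 'I_n.

Definition relabel (a : 'S_n) (x : mpoint n) : mpoint n :=
  match x with inl i => inl (a i) | inr i => inr (a i) end.

Lemma relabelK : cancel (relabel alpha) (relabel alpha^-1).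
Proof. by case=> i /=; rewrite permK. Qed.

Lemma relabelKV : cancel (relabel alpha^-1) (relabel alpha).
Proof. by case=> i /=; rewrite permKV. Qed.

Lemma relabel_Ablock i : relabel alpha @: Ablock i = Ablock (alpha i).
Proof.
apply/setP=> x; rewrite -[x]relabelKV mem_imset; last exact: can_inj relabelK.
case: {x}(relabel _ x) => j; rewrite -?/(apt _) -?/(bpt _) /=;
  by rewrite !mem_mobius_block (inj_eq (@perm_inj _ alpha)).
Qed.

Lemma relabel_Bblock i :
  relabel alpha @: Bblock phi i = Bblock (phi ^ alpha)%g (alpha i).
Proof.
apply/setP=> x; rewrite -[x]relabelKV mem_imset; last exact: can_inj relabelK.
case: {x}(relabel _ x) => j; rewrite -?/(apt _) -?/(bpt _) /=;
  by rewrite !mem_mobius_block ?permJ (inj_eq (@perm_inj _ alpha)).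
Qed.

Lemma conjg_isomorphic :
  isomorphic (mobius_pair phi) (mobius_pair (phi ^ alpha)%g).
Proof.
exists (relabel alpha); split; first by exists (relabel alpha^-1);
  [exact: relabelK | exact: relabelKV].
move=> k; split=> /mobius_blockP[] [i kE].
- by rewrite kE relabel_Ablock Ablock_in.
- by rewrite kE relabel_Bblock Bblock_in.
(* The block is the image of the one whose index is pulled back along [alpha]; taking images is
   injective on sets. *)
- move: kE; rewrite -[i](permKV alpha) -relabel_Ablock.
  by move/(imset_inj (can_inj relabelK)) ->; apply: Ablock_in.
- move: kE; rewrite -[i](permKV alpha) -relabel_Bblock.
  by move/(imset_inj (can_inj relabelK)) ->; apply: Bblock_in.
Qed.

End ConjugateToIsomorphic.

Theorem theorem3p2 (n : nat) (hn : 4 <= n) (phi psi : 'S_n) :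
  (exists alpha : 'S_n, (phi ^ alpha)%g = psi) <->
  isomorphic (mobius_pair phi) (mobius_pair psi).
Proof.
split=> [[alpha <-] | [f [f_bij f_iso]]]; first exact: conjg_isomorphic.
(* [f (apt i)] may lie in A or in B; its index names the right cycle of [psi] in either case. *)
apply: (@conjg_of_porbit_map _ _ _ (fun i => index_of (f (apt i)))) => [i j|i].
  rewrite -(connect_sparse (phi := psi) hn) (iso_connect_sparse f_bij f_iso).
  by rewrite connect_sparse.
apply: double_inj; rewrite -(card_connect_sparse (phi := psi) hn).
by rewrite (card_iso_connect_sparse f_bij f_iso) card_connect_sparse.
Qed.
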